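(* Let $(L,\mathcal{P},\Gamma)$ be a compositional computation structure satisfying the Extendibility Axiom, with $\mathcal{P}$ countable. Let $R$ be an exhaustive collection of sizers and let $\Delta\subseteq\Gamma$ be $R$-confined. The following are equivalent: (i) for every $r_\bullet\in R$, the closure of $\tilde\Delta|_{\mathcal{L}[r_\bullet]}=\{\tilde\gamma|_{\mathcal{L}[r_\bullet]}:\gamma\in\Delta\}$ in the space of all maps $\mathcal{L}[r_\bullet]\to\mathbb{R}^{\mathcal{P}}$ (pointwise convergence topology) is contained in $B_1(\mathcal{L}[r_\bullet],\mathcal{L}[r_\bullet])$; (ii) for all $P\in\mathcal{P}$, $r_\bullet\in R$, reals $a<b$ and sequences $(\gamma_n)_{n\in\mathbb{N}}\subseteq\Delta$ there are finite disjoint $E,F\subseteq\mathbb{N}$ such that $$L[r_\bullet]\cap\bigcap_{n\in E}(\pi_P\circ\gamma_n)^{-1}(-\infty,a]\cap\bigcap_{n\in F}(\pi_P\circ\gamma_n)^{-1}[b,\infty)=\emptyset.$$ Moreover, if these conditions hold, then every deep computation $f\in\overline{\Delta}$ (closure in $\mathcal{L}^L$) has an extension $\tilde f:\mathcal{L}_{\mathrm{sh}}\to\mathcal{L}_{\mathrm{sh}}$ with $\tilde f|_{\mathcal{L}[r_\bullet]}\in B_1(\mathcal{L}[r_\bullet],\mathcal{L}[r_\bullet])$ for all $r_\bullet\in R$; in particular, on each shard every deep computation is the pointwise limit of a sequence of computations (i.e., for each $r_\bullet\in R$, $\tilde f|_{\mathcal{L}[r_\bullet]}$ is the pointwise limit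 of a sequence from $\tilde\Delta|_{\mathcal{L}[r_\bullet]}$).
   Context: A computation states structure is a pair $(L,\mathcal{P})$ with $\mathcal{P}$ a set (of predicate symbols) and $L\subseteq\mathbb{R}^{\mathcal{P}}$ with the relative product topology; $\pi_P:\mathbb{R}^{\mathcal{P}}\to\mathbb{R}$ is the $P$-th coordinate projection. The type space $\mathcal{L}$ is the closure of $L$ in $\mathbb{R}^{\mathcal{P}}$. A sizer is a family $r_\bullet=(r_P)_{P\in\mathcal{P}}$ of positive reals; $L[r_\bullet]=L\cap\prod_P[-r_P,r_P]$; $\mathcal{L}[r_\bullet]$ is the closure of $L[r_\bullet]$ in $\mathbb{R}^{\mathcal{P}}$ (a compact set); $\mathcal{L}_{\mathrm{sh}}=\bigcup_{r_\bullet}\mathcal{L}[r_\bullet]$ over all sizers. A compositional computation structure is a triple $(L,\mathcal{P},\Gamma)$ with $\Gamma\subseteq L^L$ a monoid under composition containing the identity, regarded as a subset of $\mathcal{L}^L$ with the product (pointwise convergence) topology; elements of closures in $\mathcal{L}^L$ of subsets of $\Gamma$ are deep computations. A collection $R$ of sizers is exhaustive if $L=\bigcup_{r_\bullet\in R}L[r_\bullet]$; $\Delta\subseteq\Gamma$ is $R$-confined if $\gamma(L[r_\bullet])\subseteq L[r_\bullet]$ for all $\gamma\in\Delta$, $r_\bullet\in R$. A computation $\gamma\in\Gamma$ is extendable if there is $\tilde\gamma:\mathcal{L}_{\mathrm{sh}}\to\mathcal{L}_{\mathrm{sh}}$ extending $\gamma$ such that for every sizer $r_\bullet$ there is a sizer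 $s_\bullet$ with $\tilde\gamma(\mathcal{L}[r_\bullet])\subseteq\mathcal{L}[s_\bullet]$ and $\tilde\gamma|_{\mathcal{L}[r_\bullet]}:\mathcal{L}[r_\bullet]\to\mathcal{L}[s_\bullet]$ continuous (such $\tilde\gamma$ is unique). The Extendibility Axiom states that every $\gamma\in\Gamma$ is extendable. $B_1(Y,Z)$ denotes the maps $Y\to Z$ that are pointwise limits of sequences of continuous maps $Y\to Z$. *)

(* Defs.v *)
From HB Require Import structures.
From mathcomp Require Import all_boot all_order all_algebra.
From mathcomp Require Import all_classical all_reals all_analysis.
Import Order.TTheory GRing.Theory Num.Theory numFieldNormedType.Exports.

Set Implicit Arguments.
Unset Strict Implicit.
Unset Printing Implicit Defensive.

Local Open Scope classical_set_scope.
Local Open Scope ring_scope.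

(* A set [A] is used as a type through the coercion [set_type], with the
   subspace topology; [subfun] is the inclusion between two such types. *)

Record css (R : realType) := CSS {
  predicates : choiceType ;
  states : set {ptws predicates -> R} }.
Arguments states {R} c.

Record ccs (R : realType) := CCS {
  ccs_css :> css R ;
  computations : set (states ccs_css -> states ccs_css) ;
  computations1 : computations idfun ;
  computationsM : forall f g,
    computations f -> computations g -> computations (f \o g) }.
Arguments computations {R} c.

Definition coordinate (R : realType) (C : css R) (P : predicates C)
  (x : {ptws predicates C -> R}) : R := x P.

Definition baire1 (Y Z : topologicalType) : set (Y -> Z) :=
  [set f | exists u : nat -> Y -> Z,
    (forall n, continuous (u n)) /\
    (forall x, u n x @[n --> \oo] --> f x)].

Section Types.
Context {R : realType} (C : css R).
Local Notation L := (states C).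
Local Notation sizer := (predicates C -> {posnum R}).

Definition shard (r : sizer) : set {ptws predicates C -> R} :=
  L `&` [set x | forall P, coordinate P x \in `[- (r P)%:num, (r P)%:num]].

Definition types : set {ptws predicates C -> R} := closure L.

Definition type_shard (r : sizer) : set {ptws predicates C -> R} :=
  closure (shard r).

Definition shard_types : set {ptws predicates C -> R} :=
  \bigcup_(r in [set: sizer]) type_shard r.

Lemma states_sub_types : L `<=` types.
Proof. exact: subset_closure. Qed.

Lemma type_shard_sub (r : sizer) : type_shard r `<=` shard_types.
Proof. exact: bigcup_sup. Qed.

Lemma states_sub_shard_types : L `<=` shard_types.
Proof.
move=> x Lx; have r_gt0 P : 0 < `|coordinate P x| + 1 by rewrite ltr_wpDl.
apply: (@type_shard_sub (fun P => PosNum (r_gt0 P))); apply: subset_closure.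
by split => // P; rewrite in_itv/= -ler_norml lerDl.
Qed.

Definition exhaustive (S : set sizer) : Prop :=
  L = \bigcup_(r in S) shard r.

Definition confined (S : set sizer) (Delta : set (L -> L)) : Prop :=
  forall gamma r, Delta gamma -> S r ->
    gamma @` (set_val @^-1` shard r) `<=` set_val @^-1` shard r.

(* The map [h] is the restriction of [g] to the shard of [r], corestricted to
   the shard of [s]: its existence includes the inclusion of the image. *)
Definition is_extension (gamma : L -> L) (g : shard_types -> shard_types) :
    Prop :=
  (forall x : L, g (subfun states_sub_shard_types x) =
                 subfun states_sub_shard_types (gamma x)) /\
  (forall r : sizer, exists s : sizer,
    exists2 h : type_shard r -> type_shard s, continuous h &
      forall x, subfun (@type_shard_sub s) (h x) =
                g (subfun (@type_shard_sub r) x)).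

Definition extendable (gamma : L -> L) : Prop :=
  exists g, is_extension gamma g.

Definition restr (r : sizer) (g : shard_types -> shard_types)
    (x : type_shard r) : {ptws predicates C -> R} :=
  set_val (g (subfun (@type_shard_sub r) x)).

Lemma restr_continuous gamma g (r : sizer) :
  is_extension gamma g -> continuous (@restr r g).
Proof.
case=> _ /(_ r)[s [h ch hg]].
have -> : @restr r g = set_val \o h.
  by apply/funext => x; rewrite /restr -hg.
by move=> x; apply: continuous_comp; [exact: ch|exact: initial_continuous].
Qed.

(* Extensions are unique, so that quantifying over them in [ext_restr] below
   amounts to using the extension of each computation. *)
Lemma is_extension_unique gamma g1 g2 :
  is_extension gamma g1 -> is_extension gamma g2 -> g1 = g2.
Proof.
move=> ext1 ext2; apply/funext => -[x xP]; have [r _ rx] := set_mem xP.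
have -> : exist _ x xP = subfun (@type_shard_sub r) (SigSub (mem_set rx)).
  exact/val_inj.
apply/val_inj; set y : type_shard r := SigSub _.
have [c1 c2] := (restr_continuous (r:=r) ext1, restr_continuous (r:=r) ext2).
rewrite -[LHS]/(restr g1 y) -[RHS]/(restr g2 y).
have hausP : hausdorff_space {ptws predicates C -> R}.
  by apply: hausdorff_product => P; exact: Rhausdorff.
apply: hausP => A B nA nB.
have [/= _ [[U oU <-] yU sU]] : nbhs y (restr g1 @^-1` A `&` restr g2 @^-1` B).
  by apply: filterI; [exact: c1|exact: c2].
have [z [[Lz rz] Uz]] : shard r `&` U !=set0.
  by move: (rx); apply; exact: open_nbhs_nbhs.
have tz : type_shard r z by exact: subset_closure.
have Ez g : is_extension gamma g ->
    restr g (SigSub (mem_set tz)) = set_val (gamma (SigSub (mem_set Lz))).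
  move=> [/(_ (SigSub (mem_set Lz))) E _].
  transitivity (set_val (subfun states_sub_shard_types
    (gamma (SigSub (mem_set Lz))))) => //.
  by rewrite -E /restr; congr (set_val (g _)); exact/val_inj.
have [] := sU (SigSub (mem_set tz)) Uz.
rewrite /= (Ez _ ext1) (Ez _ ext2) => ? ?.
by exists (set_val (gamma (SigSub (mem_set Lz)))).
Qed.

Definition ext_restr (Delta : set (L -> L)) (r : sizer) :
    set {ptws type_shard r -> {ptws predicates C -> R}} :=
  [set restr g | g in
    [set g | exists2 gamma, Delta gamma & is_extension gamma g]].

Definition deep_computations (Delta : set (L -> L)) : set (L -> types) :=
  closure ([set subfun states_sub_types \o gamma | gamma in Delta] :
             set {ptws L -> types}).

End Types.
Arguments types {R} C.
Arguments shard_types {R} C.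
Arguments states_sub_types {R} C.
Arguments states_sub_shard_types {R} C.
Arguments restr {R C} r g.
Arguments ext_restr {R C} Delta r.
Arguments baire1 : clear implicits.

Definition extendability_axiom (R : realType) (C : ccs R) : Prop :=
  forall gamma, computations C gamma -> extendable gamma.

(* Main.v *)
Require Import Defs.
From HB Require Import structures.
From mathcomp Require Import all_boot all_order all_algebra.
From mathcomp Require Import all_classical all_reals all_analysis.
Import Order.TTheory GRing.Theory Num.Theory numFieldNormedType.Exports.

Local Open Scope classical_set_scope.
Local Open Scope ring_scope.

(* For (i) => (ii), negating (ii) gives computations whose extensions are
   independent at the levels a < b on a compact shard; an ultrafilter limit f of
   these extensions then takes values <= a and values >= b on every relatively
   open subset of a suitable minimal closed set, and a Baire category argument
   shows that f is not a limit of continuous maps.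

   For (ii) => (i) (a form of the Bourgain-Fremlin-Talagrand theorem) one may
   replace the restrictions of the extensions by a countable dense family h_n,
   so that f is the limit of h_n along an ultrafilter p on nat.  For each
   coordinate and each pair of rational levels, the absence of independent
   sequences means that a player who names a side of f and lets the opponent
   choose n in a set of p wins by reaching constraints without a common
   solution.  A sequence that eventually lies in each of the countably many sets
   of p occurring in winning strategies converges to f at every point.

   A deep computation is extended to the shards by taking limits of the extended
   computations along an ultrafilter. *)

(** * Convergence, ultrafilters and compactness *)

Lemma initial_cvgP (S : choiceType) (T : topologicalType) (f : S -> T)
    (F : set_system S) (s : S) : Filter F ->
  F --> (s : initial_topology f) <-> f @ F --> f s.
Proof.
move=> FF; split=> [Fs A /(@initial_continuous _ _ f s)/Fs //|Fs A].
move=> [_ [[B oB <-] Bs] BA]; apply: filterS BA _.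
by apply: Fs; exact: open_nbhs_nbhs.
Qed.

Lemma subtype_cvgP (T : topologicalType) (A : set T) (F : set_system A)
    (x : A) : Filter F -> F --> x <-> set_val @ F --> set_val x.
Proof. exact: initial_cvgP. Qed.

Lemma ptws_cvgP (I : Type) (T : topologicalType)
    (F : set_system {ptws I -> T}) (f : {ptws I -> T}) : Filter F ->
  F --> f <-> forall i, (fun g : {ptws I -> T} => g i) @ F --> f i.
Proof.
move=> FF; split=> [/cvg_sup Ff i|Ff].
  by apply/(@initial_cvgP _ T (fun g : {ptws I -> T} => g i)); exact: Ff.
by apply/cvg_sup => i; apply/initial_cvgP; exact: Ff.
Qed.

Lemma closure_image_cvg (I : Type) (T : topologicalType) (h : I -> T)
    (A : set I) (p : set_system I) (f : T) : ProperFilter p ->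
  p A -> h @ p --> f -> closure (h @` A) f.
Proof.
move=> pp pA hf B nB; have pB : p (h @^-1` B) := hf B nB.
by have [i [Ai Bi]] := filter_ex (filterI pA pB); exists (h i); split => //;
  exists i.
Qed.

(** The traces on [A] of the preimages of neighbourhoods of [f] generate a proper filter; any finer
    ultrafilter will do. *)
Lemma closure_image_ultra (I : Type) (T : topologicalType) (h : I -> T)
    (A : set I) (f : T) : closure (h @` A) f ->
  exists p : set_system I, [/\ UltraFilter p, p A & h @ p --> f].
Proof.
move=> Af; pose F := filter_from (nbhs f) (fun U => A `&` h @^-1` U).
have FF : ProperFilter F.
  apply: filter_from_proper.
    apply: filter_from_filter; first by exists setT; exact: filterT.
    move=> U V nU nV; exists (U `&` V); first exact: filterI.
    by move=> i [Ai [Ui Vi]].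
  by move=> U /Af [_ [[i Ai <-] Ui]]; exists i.
have [p [pU Fp]] := ultraFilterLemma FF; exists p; split => //.
  by apply: Fp; exists setT; [exact: filterT|move=> i []].
by move=> U nU; apply: Fp; exists U => // i [].
Qed.

(** A cluster point of an ultrafilter is a limit, because the ultrafilter decides the preimage of
    each neighbourhood. *)
Lemma compact_ultra_cvg (I : Type) (T : topologicalType) (K : set T)
    (p : set_system I) (h : I -> T) : compact K -> UltraFilter p ->
  p (h @^-1` K) -> exists2 y, K y & h @ p --> y.
Proof.
move=> cK pU pK.
have [y [Ky hy]] := cK (h @ p) (fmap_proper_filter h _) pK.
exists y => // U nU.
have [//|pN] := in_ultra_setVsetC (h @^-1` U) pU.
have [z [nUz Uz]] := hy (~` U) U pN nU.
by have := nUz Uz.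
Qed.

Lemma compact_subtype (T : topologicalType) (K : set T) :
  compact K -> compact [set: K].
Proof.
move=> cK F FF _; have FK : (set_val @ F) K.
  by apply: (@filterS _ F) filterT => x _; exact: set_valP.
have [y [Ky Fy]] := cK (set_val @ F) (fmap_proper_filter set_val _) FK.
exists (SigSub (mem_set Ky)); split => // A B FA [_ [[V oV <-] Vy] VB].
have [] := Fy (set_val @` A) V.
- by apply: (@filterS _ F) FA => x Ax; exists x.
- exact: open_nbhs_nbhs.
by move=> _ [[x Ax <-] Vx]; exists x; split => //; exact: VB.
Qed.

Lemma compact_directed (T : topologicalType) (I : Type) (D : set I)
    (C : I -> set T) : compact [set: T] -> D !=set0 ->
  (forall i, D i -> closed (C i)) -> (forall i, D i -> C i !=set0) ->
  (forall i j, D i -> D j -> exists2 k, D k & C k `<=` C i `&` C j) ->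
  exists x, forall i, D i -> C i x.
Proof.
move=> cT [i0 Di0] cC nC dC.
have FF : ProperFilter (filter_from D C).
  by apply: filter_from_proper => //; apply: filter_from_filter => //;
    exists i0.
have [x [_ clx]] := cT _ FF filterT.
exists x => i Di; apply: cC => // B nB; apply: clx => //; exists i => //.
Qed.

Lemma continuous_to_subtype (S T : topologicalType) (A : set T) (f : S -> A) :
  continuous (set_val \o f) -> continuous f.
Proof. by move=> cf x; apply/subtype_cvgP; exact: cf. Qed.

Lemma cvg_set_val (I : Type) (T : topologicalType) (A : set T)
    (F : set_system I) (h : I -> A) (x : A) :
  h @ F --> x -> set_val (h i) @[i --> F] --> set_val x.
Proof.
by move=> hx U nU; apply: (hx (set_val @^-1` U)); exact: initial_continuous nU.
Qed.

(** * Games along an ultrafilter *)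

(* A strategy of the first player: [Node e B c] names the side [e] and restricts
   the opponent to the indices [n] in [B]; the play continues with [c n]. *)
Inductive game_tree :=
  Leaf | Node of bool & set nat & (nat -> game_tree).

Fixpoint subtree (t : game_tree) (l : seq nat) {struct l} : game_tree :=
  if l is n :: l' then
    if t is Node _ _ c then subtree (c n) l' else Leaf
  else t.

Lemma subtree_rcons t l n e B c :
  subtree t l = Node e B c -> subtree t (rcons l n) = c n.
Proof.
elim: l t => [|k l IH] t /= => [->//|].
by case: t => [|e' B' c' /IH//]; case: l {IH}.
Qed.

Section Sampling.
Context (T : Type) (p : set_system nat) {pU : UltraFilter p}.

(** [s] lists the constraints played so far, latest first. *)
Fixpoint winning (A : bool -> nat -> set T) (s : seq (nat * bool))
    (t : game_tree) : Prop :=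
  match t with
  | Leaf => forall x, ~ (forall u, u \in s -> A u.2 u.1 x)
  | Node e B c => p B /\ forall n, B n -> winning A ((n, e) :: s) (c n)
  end.

(** If the indices with a winning continuation formed a set of [p], gluing these continuations would
    give a winning strategy from [s]. *)
Lemma not_winning_cons A s : ~ (exists t, winning A s t) ->
  forall e, p [set n | ~ exists t, winning A ((n, e) :: s) t].
Proof.
move=> nW e; pose B := [set n | exists t, winning A ((n, e) :: s) t].
have [pB|//] := in_ultra_setVsetC B pU; exfalso; apply: nW.
have /choice[c cB] : forall n, exists t, B n -> winning A ((n, e) :: s) t.
  move=> n.
  by have [[t wt]|nB] := pselect (B n); [exists t | exists Leaf].
by exists (Node e B c).
Qed.

(** Without a winning strategy there is an infinite sequence of indices none of whose prefixes is
    winning for any choice of sides; but [Leaf] wins as soon as the constraints have no common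
    solution. *)
Lemma winning_nil A :
  (forall m : nat -> nat, exists k (e : nat -> bool), forall x,
    ~ forall i, (i < k)%N -> A (e i) (m i) x) ->
  exists t, winning A [::] t.
Proof.
move=> depA; apply: contrapT => nW.
pose good l := forall bs, size bs = size l ->
  ~ exists t, winning A (zip l bs) t.
have goodS l : good l -> exists n, good (n :: l).
  move=> gl; suff pn : p [set n | good (n :: l)] by exact: (filter_ex pn).
  (* A prefix has finitely many side patterns, so one index serves all of them. *)
  have : \forall n \near p, forall (bs : (size l).-tuple bool) (e : bool),
      ~ exists t, winning A ((n, e) :: zip l bs) t.
    apply: filter_forall => bs; apply: filter_forall => e.
    by apply: not_winning_cons; apply: gl; rewrite size_tuple.
  apply: filterS => n gn [|e bs]//= [sbs].
  by have /eqP sb := sbs; exact: (gn (Tuple sb) e).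
have /choice[nx nxP] : forall l, exists n, good l -> good (n :: l).
  move=> l.
  have [/goodS[n gn]|ngl] := pselect (good l); first by exists n.
  by exists 0%N.
pose L k := iter k (fun l => nx l :: l) [::].
have gL k : good (L k).
  elim: k => [bs /size0nil ->|k]; [exact: nW | exact: nxP].
have [k [e ke]] := depA (nx \o L).
pose bs j := iteri j (fun i l => e i :: l) [::].
have zE j : zip (L j) (bs j) =
    iteri j (fun i l => (nx (L i), e i) :: l) [::].
  by elim: j => //= j ->.
apply: (gL k (bs k)).
  by elim: k {ke} => //= k ->.
exists Leaf => x xP; apply: (ke x) => i ik.
have /xP// : (nx (L i), e i) \in zip (L k) (bs k).
rewrite zE; elim: k ik {ke xP zE} => //= k IH; rewrite ltnS leq_eqVlt inE.
by case/predU1P => [->|/IH ->]; rewrite ?eqxx ?orbT.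
Qed.

(* At a point on side [e] of the limit, play the strategy: on the side [e]
   answer with an index good for [x] in the ultrafilter, on the other side with
   a member of the sequence.  The play ends in constraints satisfied by [x]. *)
Lemma winning_sample (J : countType) (A : J -> bool -> nat -> set T)
    (t : J -> game_tree) : (forall j, winning (A j) [::] (t j)) ->
  exists g : nat -> nat, forall j e x, p [set n | A j e n x] ->
    \forall n \near \oo, ~ A j (~~ e) (g n) x.
Proof.
move=> wt.
(* The positions of all strategies form a countable type; at a leaf the default [setT] imposes
   nothing. *)
pose B (c : J * seq nat) :=
  if subtree (t c.1) c.2 is Node _ B _ then B else setT.
(* Only finitely many positions have code at most [n], so a single index lies in all of their sets
   that belong to [p]. *)
have /choice[g gP] : forall n, exists k, forall c,
    (pickle c <= n)%N -> p (B c) -> B c k.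
  move=> n.
  suff pn : p [set k | forall c, (pickle c <= n)%N -> p (B c) -> B c k].
    exact: (filter_ex pn).
  have : \forall k \near p, forall (i : 'I_n.+1) c, pickle c = i ->
      p (B c) -> B c k.
    apply: filter_forall => i.
    have [[c [ci pc]]|nc] := pselect (exists c, pickle c = i /\ p (B c)).
      apply: filterS pc => k Bk c' ci' _.
      by move: ci'; rewrite -ci => /(pcan_inj pickleK) ->.
    by apply: nearW => k c ci pc; exfalso; apply: nc; exists c.
  by apply: filterS => k Hk c cn; apply: (Hk (Ordinal (cn : (_ < n.+1)%N))).
exists g => j e x pe; apply: contrapT => nev.
have freq N : exists2 n, (N <= n)%N & A j (~~ e) (g n) x.
  apply: contrapT => nN; apply: nev; exists N => // n /= Nn An.
  by apply: nN; exists n.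
suff H tt : forall l s, subtree (t j) l = tt -> winning (A j) s tt ->
    (forall u, u \in s -> A j u.2 u.1 x) -> False.
  by apply: (H (t j) [::] [::]) => //; exact: wt.
elim: tt => [l s _ /= + sx|e' D c IH l s tl /= [pD cD] sx].
  by move=> /(_ x); exact.
have [n Dn Ax] : exists2 n, D n & A j e' n x.
  have [->|ne] := eqVneq e' e.
    by have [n [Dn An]] := filter_ex (filterI pD pe); exists n.
  have -> : e' = ~~ e by move: ne; case: (e'); case: (e).
  have [n ln An] := freq (pickle (j, l)); exists (g n) => //.
  by have := gP n (j, l) ln; rewrite /B/= tl; apply.
apply: (IH n (rcons l n) ((n, e') :: s)).
- exact: subtree_rcons tl.
- exact: cD.
by move=> u; rewrite inE => /predU1P[->//|]; exact: sx.
Qed.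

End Sampling.
Arguments winning {T} p A s t.
Arguments winning_nil {T p pU} A.
Arguments winning_sample {T p pU J A t}.

(** * From ultrafilter limits to sequential limits *)

Lemma rat_between {R : realType} {x y : R} : x < y ->
  exists2 q : rat, x < ratr q & ratr q < y.
Proof.
by move=> /rat_in_itvoo[q]; rewrite in_itv/= => /andP[]; exists q.
Qed.

Lemma countable_index {Q : choiceType} : countable [set: Q] ->
  exists iQ : Q -> nat, injective iQ.
Proof.
by move=> /countable_injP[iQ inj]; exists iQ => q q' E; apply: inj;
  rewrite ?inE.
Qed.

(** With coordinates coded by naturals and levels by rationals there are countably many games, so
    one sampled sequence handles all of them. *)
Lemma ultra_limit_sequence {R : realType} {T : Type} {Q : choiceType}
    (p : set_system nat) (h : nat -> T -> Q -> R) (f : T -> Q -> R) :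
  countable [set: Q] -> UltraFilter p ->
  (forall x q, h n x q @[n --> p] --> f x q) ->
  (forall q (a b : R) (m : nat -> nat), a < b ->
    exists k (e : nat -> bool), forall x, ~ forall i, (i < k)%N ->
      if e i then b <= h (m i) x q else h (m i) x q <= a) ->
  exists g : nat -> nat, forall x q, h (g n) x q @[n --> \oo] --> f x q.
Proof.
move=> /countable_index[iQ iQ_inj] pU hf dep.
pose A (j : nat * rat * rat) (e : bool) n : set T :=
  [set x | exists q, [/\ iQ q = j.1.1, j.1.2 < j.2 &
    if e then ratr j.2 <= h n x q else h n x q <= ratr j.1.2]].
have /choice[t wt] j : exists t, winning p (A j) [::] t.
  apply: winning_nil => m.
  have [[q [qj ab]]|nq] := pselect (exists q, iQ q = j.1.1 /\ j.1.2 < j.2).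
    have [|k [e ke]] := dep q (ratr j.1.2) (ratr j.2) m.
      by rewrite ltr_rat.
    exists k, e => x xA; apply: (ke x) => i /xA[q' [q'j _]].
    by have /iQ_inj -> : iQ q' = iQ q by rewrite qj.
  (* If the code is not taken or the levels are out of order, every constraint is empty and one move
     suffices. *)
  exists 1%N, xpredT => x /(_ 0%N isT)[q [qj ab _]].
  by apply: nq; exists q.
have [g gP] := winning_sample wt; exists g => x q.
(* Rational levels inserted between [a] and [b] turn values beyond one level along [p] into values
   eventually beyond the other along [g]. *)
have between e (a b : R) : a < b -> (\forall n \near p,
    if e then b < h n x q else h n x q < a) ->
    \forall n \near \oo, if e then a < h (g n) x q else h (g n) x q < b.
  move=> ab pe; have [a' aa' a'b] := rat_between ab.
  have [b' ab' bb'] := rat_between a'b.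
  have lt' : a' < b' by rewrite -(ltr_rat R).
  case: e pe => pe.
    have /gP : p [set n | A (iQ q, a', b') true n x].
      apply: filterS pe => n bn; exists q; split => //=.
      exact: ltW (lt_trans bb' bn).
    apply: filterS => n nA; rewrite ltNge; apply/negP => na; apply: nA.
    by exists q; split => //=; exact: le_trans na (ltW aa').
  have /gP : p [set n | A (iQ q, a', b') false n x].
    apply: filterS pe => n bn; exists q; split => //=.
    exact: ltW (lt_trans bn aa').
  apply: filterS => n nA; rewrite ltNge; apply/negP => na; apply: nA.
  by exists q; split => //=; exact: le_trans (ltW bb') na.
apply/cvgrPdist_lt => e e0.
have := between true (f x q - e) (f x q - e / 2) _ _.
have := between false (f x q + e / 2) (f x q + e) _ _.
have e20 : 0 < e / 2 by rewrite divr_gt0.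
have e2e : e / 2 < e by rewrite ltr_pdivrMr// ltr_pMr// ltr1n.
rewrite ltrD2l ltrD2l ltrN2 => /(_ e2e) H1 /(_ e2e) H2.
have [{}H1 {}H2] : (\forall n \near \oo, h (g n) x q < f x q + e) /\
    (\forall n \near \oo, f x q - e < h (g n) x q).
  split; [apply: H1 | apply: H2].
    by apply: (cvgr_lt (f x q)) => //; rewrite ltrDl.
  by apply: (cvgr_gt (f x q)) => //; rewrite gtrBl.
near=> n; rewrite ltr_distlC; apply/andP; split; near: n; first exact: H2.
exact: H1.
Unshelve. all: by end_near. Qed.

(** * Independent sequences and Baire category *)

Section Independence.
Context {R : realType} {T : topologicalType} (v : nat -> T -> R) (a b : R).
Hypotheses (cT : compact [set: T]) (cv : forall n, continuous (v n)).
Hypothesis ab : a < b.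

Definition cell (k : nat) (e : nat -> bool) : set T :=
  [set x | forall i, (i < k)%N -> if e i then b <= v i x else v i x <= a].

Definition gapped : set T := [set x | forall i, v i x <= a \/ b <= v i x].

Let closed_v_le n (c : R) : closed [set x | v n x <= c].
Proof.
apply: (@preimage_closed _ _ (v n) [set y | y <= c]); last exact: closed_le.
by move=> x _; exact: cv.
Qed.

Let closed_v_ge n (c : R) : closed [set x | c <= v n x].
Proof.
apply: (@preimage_closed _ _ (v n) [set y | c <= y]); last exact: closed_ge.
by move=> x _; exact: cv.
Qed.

Lemma cell_closed k e : closed (cell k e).
Proof.
have -> : cell k e = \bigcap_(i in [set i | (i < k)%N])
    [set x | if e i then b <= v i x else v i x <= a] by [].
by apply: closed_bigI => i _; case: (e i).
Qed.

Lemma gapped_closed : closed gapped.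
Proof.
have -> : gapped = \bigcap_i ([set x | v i x <= a] `|` [set x | b <= v i x]).
  by apply/seteqP; split=> [x gx i _|x gx i]; [exact: gx | exact: gx].
by apply: closed_bigI => i _; exact: closedU.
Qed.

Lemma cell_le k l e : (k <= l)%N -> cell l e `<=` cell k e.
Proof. by move=> kl x xl i ik; apply: xl; exact: leq_trans kl. Qed.

Lemma in_all_cells_gapped e x : (forall k, cell k e x) -> gapped x.
Proof.
by move=> xe i; have := xe i.+1 i (ltnSn i); case: (e i); [right | left].
Qed.

Hypothesis indep : forall k e, cell k e !=set0.

(** Cantor's intersection theorem; the cells need to decrease only on [Z]. *)
Let nested (Z : set T) (ke : nat -> nat * (nat -> bool)) : closed Z ->
  (forall n, Z `&` cell (ke n).1 (ke n).2 !=set0) ->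
  (forall n, Z `&` cell (ke n.+1).1 (ke n.+1).2 `<=` cell (ke n).1 (ke n).2) ->
  exists2 x, Z x & forall n, cell (ke n).1 (ke n).2 x.
Proof.
move=> cZ nZ dec.
have mono m n : (m <= n)%N ->
    Z `&` cell (ke n).1 (ke n).2 `<=` Z `&` cell (ke m).1 (ke m).2.
  elim: n => [|n IH]; first by rewrite leqn0 => /eqP ->.
  rewrite leq_eqVlt ltnS => /predU1P[-> //|/IH mn] x xn; apply: mn.
  by split; [case: xn | exact: dec].
have [||||x xZ] := @compact_directed T nat setT
  (fun n => Z `&` cell (ke n).1 (ke n).2) cT.
- by exists 0%N.
- by move=> n _; apply: closedI => //; exact: cell_closed.
- by move=> n _; exact: nZ.
- move=> i j _ _; exists (maxn i j) => // x xij.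
  by split; apply: mono xij; [exact: leq_maxl | exact: leq_maxr].
by exists x => [|n]; [have [] := xZ 0%N I | have [] := xZ n I].
Qed.

(** Stated for complements: a maximal thick open set yields a minimal closed set of gapped points
    meeting every cell. *)
Let thick (U : set T) := open U /\
  forall k e, exists x, [/\ cell k e x, gapped x & ~ U x].

Let thick0 : thick set0.
Proof.
split=> [|k e]; first exact: open0.
(* Prolonging the pattern by [false] decides every index, so a point that realises it is gapped. *)
pose e' i := (i < k)%N && e i.
have [|n|n|x _ xe] := @nested setT (fun n => (n, e')); first exact: closedT.
- by have [x xn] := indep n e'; exists x.
- by move=> x [_ /cell_le]; apply.
exists x; split => //; last exact: in_all_cells_gapped xe.
by move=> i ik; have := xe k i ik; rewrite /= /e' ik.
Qed.

(* Zorn's lemma; the last clause expresses the minimality of [Z]. *)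
Lemma minimal_gapped : exists Z : set T, [/\ closed Z, Z `<=` gapped,
  forall k e, Z `&` cell k e !=set0 &
  forall V, open V -> Z `&` V !=set0 -> exists k e, Z `&` cell k e `<=` V].
Proof.
have [F sF tF|U [[oU tU] maxU]] := @Zorn_bigcup T thick.
  have [[U0 FU0]|F0] := pselect (F !=set0); last first.
    have -> : F = set0 by apply/seteqP; split=> // U FU; apply: F0; exists U.
    by rewrite bigcup_set0; exact: thick0.
  split=> [|k e]; first by apply: bigcup_open => U /sF[].
  (* Along a chain the closed sets of admissible points are nested; compactness gives a point
     outside the whole union. *)
  have [||||x xF] := @compact_directed T _ F
      (fun U => cell k e `&` gapped `&` ~` U) cT.
  - by exists U0.
  - move=> U /sF[oU _]; apply: closedI; last exact: open_closedC.
    by apply: closedI; [exact: cell_closed | exact: gapped_closed].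
  - by move=> U /sF[_ /(_ k e)[x [? ? ?]]]; exists x.
  - move=> U V FU FV; have [UV|VU] := tF U V FU FV.
      by exists V => // x [xC nV]; split; split => //; move=> /UV.
    by exists U => // x [xC nU]; split; split => //; move=> /VU.
  have [[xc xg] _] := xF U0 FU0; exists x; split => //.
  by move=> [U FU Ux]; have [_] := xF U FU; exact.
exists (gapped `&` ~` U); split.
- by apply: closedI; [exact: gapped_closed | exact: open_closedC].
- by move=> x [].
- by move=> k e; have [x [? ? ?]] := tU k e; exists x.
move=> V oV [y [[gy nUy] Vy]]; apply: contrapT => nV.
(* If [V] contained no trace of a cell, adding [V] to [U] would preserve thickness and contradict
   maximality. *)
apply: (maxU (U `|` V)).
  by split=> [x|/(_ y)]; [left | apply: contra_not nUy; apply; right].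
split=> [|k e]; first exact: openU.
apply: contrapT => nx; apply: nV; exists k, e => x [[gx nUx] xc].
by apply: contrapT => nVx; apply: nx; exists x; split => // -[].
Qed.

(** The last three hypotheses are what is kept of [f] being an ultrafilter limit of the [v n]; [w]
    witnesses that [f] is of the first Baire class. *)
Context (f : T -> R) (w : nat -> T -> R).
Hypotheses (cw : forall n, continuous (w n))
  (wf : forall x, w n x @[n --> \oo] --> f x)
  (f_le : forall x, (\forall n \near \oo, v n x <= a) -> f x <= a)
  (f_ge : forall x, (\forall n \near \oo, b <= v n x) -> b <= f x)
  (f_gap : forall x, gapped x -> f x <= a \/ b <= f x).

(* On the minimal set both [f <= a] and [f >= b] are dense, which contradicts
   the Baire category theorem; the nested cells below play the role of the
   balls in its proof. *)
Lemma independent_not_baire1 : False.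
Proof.
have [Z [cZ Zg nZ Zmin]] := minimal_gapped; pose c := (a + b) / 2.
have ac : a < c by rewrite midf_lt.
have cb : c < b by rewrite midf_lt.
(* Each cell contains, on [Z], a cell where some late [w m] lies on a prescribed side of [c]. *)
have refine k e n (s : bool) : exists ke, Z `&` cell ke.1 ke.2 `<=`
    cell k e `&` [set x | exists2 m, (n <= m)%N &
                          if s then c < w m x else w m x < c].
  (* A point following [e] and then constantly [s] has its value of [f] on side [s], hence also the
     late values of [w]. *)
  pose e' i := if (i < k)%N then e i else s.
  have [l|l|x Zx xe] := @nested Z (fun l => (l, e')) cZ.
  - exact: nZ.
  - by move=> x [_ /cell_le]; apply.
  have xk : cell k e x by move=> i ik; have := xe k i ik; rewrite /= /e' ik.
  have [m nm wm] : exists2 m, (n <= m)%N & if s then c < w m x else w m x < c.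
    have fx : if s then b <= f x else f x <= a.
      case: (s) @e' xe => e' xe; [apply: f_ge | apply: f_le];
        exists k => // i /= ki;
        by have := xe i.+1 i (ltnSn i); rewrite /= /e' ltnNge ki.
    suff [N _ /(_ (maxn N n))] : \forall m \near \oo,
        if s then c < w m x else w m x < c.
      move=> /(_ (leq_maxl _ _)) wN; exists (maxn N n) => //.
      exact: leq_maxr.
    case: (s) fx => fx.
      by apply: (cvgr_gt (f x)); [exact: wf | exact: lt_le_trans fx].
    by apply: (cvgr_lt (f x)); [exact: wf | exact: le_lt_trans ac].
  (* Strict inequalities make [V] a neighbourhood of [x]; on [Z], where no [v i] takes a value
     between the levels, they give back the constraints of the cell. *)
  pose V := [set y | (if s then c < w m y else w m y < c) /\
    forall i : 'I_k, if e i then a < v i y else v i y < b].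
  have nV : nbhs x V.
    apply: filterI; first by move: wm; case: (s) => wm;
      [exact: (cvgr_gt _ (cw m x)) | exact: (cvgr_lt _ (cw m x))].
    apply: filter_forall => i; have := xk i (ltn_ord i); case: (e i) => vi.
      by apply: (cvgr_gt _ (cv i x)); exact: lt_le_trans vi.
    by apply: (cvgr_lt _ (cv i x)); exact: le_lt_trans ab.
  have [|l [e2 sV]] := Zmin (interior V) (open_interior V).
    by exists x; split; [exact: Zx | exact: nV].
  exists (l, e2) => y [Zy ye].
  have [wy vy] := interior_subset (sV y (conj Zy ye)).
  split; last by exists m.
  move=> i ik; have /= := vy (Ordinal ik).
  by case: (Zg y Zy i) => vi; case: (e i) => //; rewrite ltNge vi.
have /choice[nx nxP] : forall ken, exists ke, Z `&` cell ke.1 ke.2 `<=`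
    cell ken.1.1 ken.1.2 `&`
    [set x | (exists2 m, (ken.2 <= m)%N & c < w m x) /\
             (exists2 m, (ken.2 <= m)%N & w m x < c)].
  move=> [[k e] n]; have [[k1 e1] s1] := refine k e n true.
  have [[k2 e2] s2] := refine k1 e1 n false.
  exists (k2, e2) => x [Zx x2]; have [x1 lt2] := s2 x (conj Zx x2).
  by have [x0 lt1] := s1 x (conj Zx x1).
(* Starting from the whole space, stage [n] forces values of [w] with index at least [n] on both
   sides of [c]. *)
pose ke := nat_rect _ (0%N, xpredT) (fun n r => nx (r, n)).
have [|n x|x Zx xke] := @nested Z ke cZ.
- by move=> n; exact: nZ.
- by move=> /nxP[].
have wx n : (exists2 m, (n <= m)%N & c < w m x) /\
            (exists2 m, (n <= m)%N & w m x < c).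
  by have [//] := nxP (ke n, n) x (conj Zx (xke n.+1)).
have [fa|bf] := f_gap x (Zg x Zx).
  have [N _ wN] : \forall n \near \oo, w n x < c.
    by apply: (cvgr_lt (f x)); [exact: wf | exact: le_lt_trans ac].
  by have [[m /wN/= wm]] := wx N; rewrite ltNge (ltW wm).
have [N _ wN] : \forall n \near \oo, c < w n x.
  by apply: (cvgr_gt (f x)); [exact: wf | exact: lt_le_trans bf].
by have [_ [m /wN/= wm]] := wx N; rewrite ltNge (ltW wm).
Qed.

End Independence.

(** * Separability for pointwise convergence *)

Section Separability.
Context {R : realType} {Q : choiceType} (iQ : Q -> nat).
Hypothesis iQ_inj : injective iQ.

(** A countable base of the product: finitely many rational bounds, on coordinates named by their
    codes. A code that is not taken imposes nothing. *)
Definition box (l : seq (nat * rat * rat)) : set {ptws Q -> R} :=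
  [set y | forall j, j \in l -> forall q, iQ q = j.1.1 ->
    ratr j.1.2 < y q < ratr j.2].

Lemma box_cat l1 l2 : box (l1 ++ l2) = box l1 `&` box l2.
Proof.
apply/seteqP; split=> [y yl|y [y1 y2] j].
  by split=> j jl; apply: yl; rewrite mem_cat jl ?orbT.
by rewrite mem_cat => /orP[/y1|/y2].
Qed.

Lemma box_nbhs l y : box l y -> nbhs y (box l).
Proof.
elim: l => [_|j l IH]; first by apply: filterS filterT => z _ j.
rewrite -cat1s box_cat => -[yj yl]; apply: filterI; last exact: IH.
have [[q qj]|nq] := pselect (exists q, iQ q = j.1.1); last first.
  apply: filterS filterT => z _ j'; rewrite inE => /eqP -> q qj.
  by case: nq; exists q.
have cq : (fun z : {ptws Q -> R} => z q) @ y --> y q.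
  by have /ptws_cvgP : y --> y by exact: cvg_id.
have /andP[ay yb] := yj j (mem_head _ _) q qj.
near=> z; move=> j'; rewrite inE => /eqP -> q' q'j.
have -> : q' = q by apply: iQ_inj; rewrite qj.
apply/andP; split; near: z; first exact: (cvgr_gt _ cq).
exact: (cvgr_lt _ cq).
Unshelve. all: by end_near. Qed.

Lemma nbhs_box y U : nbhs y U -> exists2 l, box l y & box l `<=` U.
Proof.
pose F := filter_from [set l | box l y] box.
have FF : Filter F.
  apply: filter_from_filter; first by exists [::].
  by move=> l1 l2 y1 y2; exists (l1 ++ l2); rewrite /= box_cat.
suff : F --> y by move=> /[apply].
apply/ptws_cvgP => q; apply/cvgrPdist_lt => e e0.
have [a ea ay] : exists2 a : rat, y q - e < ratr a & ratr a < y q.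
  by apply: rat_between; rewrite gtrBl.
have [b yb be] : exists2 b : rat, y q < ratr b & ratr b < y q + e.
  by apply: rat_between; rewrite ltrDl.
exists [:: (iQ q, a, b)].
  by move=> j; rewrite inE => /eqP -> q' /= /iQ_inj ->; rewrite ay yb.
move=> z /(_ _ (mem_head _ _) q erefl)/andP[/= az zb].
by rewrite /= ltr_distlC (lt_trans ea az) (lt_trans zb be).
Qed.

(** For each of the countably many finite lists of conditions sending a box into a box, one member
    of [A] satisfying the list is chosen, if there is any. *)
Lemma ptws_separable (K : set {ptws Q -> R})
    (A : set {ptws K -> {ptws Q -> R}}) : A !=set0 ->
  (forall g, A g -> continuous g) ->
  exists2 d : nat -> {ptws K -> {ptws Q -> R}},
    forall n, A (d n) & A `<=` closure (range d).
Proof.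
move=> [g0 Ag0] cA.
pose boxes := seq (nat * rat * rat).
pose sat (c : seq (boxes * boxes)) (g : {ptws K -> {ptws Q -> R}}) :=
  forall u, u \in c -> forall x : K, box u.1 (set_val x) -> box u.2 (g x).
have /choice[dc dcP] : forall c, exists d,
    A d /\ ((exists2 g, A g & sat c g) -> sat c d).
  move=> c; have [[g Ag cg]|ng] := pselect (exists2 g, A g & sat c g).
    by exists g.
  by exists g0; split => // /ng.
exists (fun n => dc (odflt [::] (unpickle n))) => [n|].
  by have [] := dcP (odflt [::] (unpickle n)).
(* The chosen members converge to [g] as the list of conditions satisfied by [g] grows. *)
move=> g Ag; pose F := filter_from (fun c => sat c g)
  (fun c => [set c' | sat c' g /\ {subset c <= c'}]).
have FF : ProperFilter F.
  apply: filter_from_proper; last by move=> c cg; exists c; split.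
  apply: filter_from_filter; first by exists [::].
  move=> c1 c2 c1g c2g; exists (c1 ++ c2).
    by move=> u; rewrite mem_cat => /orP[/c1g|/c2g].
  move=> c [cg sc]; split; split=> // u uc; apply: sc;
    by rewrite mem_cat uc ?orbT.
have : closure (dc @` setT) g.
  apply: (@closure_image_cvg _ _ dc setT F g FF (@filterT _ F _)).
  apply/ptws_cvgP => x U /nbhs_box[l' gl' l'U].
  have [_ [[V oV <-] Vx] sV] := cA g Ag x _ (box_nbhs _ _ gl').
  have [l xl lV] := nbhs_box _ _ (open_nbhs_nbhs (conj oV Vx)).
  exists [:: (l, l')].
    by move=> u; rewrite inE => /eqP -> z /lV/sV.
  move=> c [cg sc]; apply: l'U.
  have [_ /(_ (ex_intro2 _ _ g Ag cg)) dcc] := dcP c.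
  by apply: (dcc (l, l')) => //; apply: sc; rewrite inE.
apply: closureS => _ [c _ <-]; exists (pickle c) => //.
by rewrite pickleK.
Qed.

End Separability.

(** * Shards and extended computations *)

Section Shards.
Context {R : realType} {C : css R}.
Implicit Types (r : predicates C -> {posnum R}) (gamma : states C -> states C)
  (Delta : set (states C -> states C)).

Lemma type_shard_compact r : compact (type_shard r).
Proof.
pose B : set {ptws predicates C -> R} :=
  [set x | forall P, `[- (r P)%:num, (r P)%:num]%classic (x P)].
have cB : compact B.
  exact: (@tychonoff _ _ (fun P => `[- (r P)%:num, (r P)%:num]%classic)
    (fun P => @segment_compact R _ _)).
have clB : closed B.
  apply: compact_closed cB.
  by apply: hausdorff_product => P; exact: Rhausdorff.
apply: subclosed_compact cB _; first exact: closed_closure.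
move=> x xr; apply: clB; move: x xr.
by apply: closureS => x [_ xr] P; exact: xr.
Qed.

Lemma shard_dense r (y : type_shard r) (U : set (type_shard r)) :
  nbhs y U -> exists z, shard r (set_val z) /\ U z.
Proof.
move=> [_ [[V oV <-] Vy] VU].
have [z [rz Vz]] := set_valP y V (open_nbhs_nbhs (conj oV Vy)).
by exists (SigSub (mem_set (subset_closure rz))); split => //; exact: VU.
Qed.

Lemma restr_states gamma g r (x : states C) (y : type_shard r) :
  is_extension gamma g -> set_val x = set_val y ->
  restr r g y = set_val (gamma x).
Proof.
move=> [gE _] xy; rewrite /restr.
have -> : subfun (@type_shard_sub _ _ r) y =
    subfun (states_sub_shard_types C) x.
  exact/val_inj.
by rewrite gE.
Qed.

Lemma shard_states r (y : type_shard r) : shard r (set_val y) ->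
  exists2 x : states C, set_val x = set_val y & shard r (set_val x).
Proof. by move=> ry; exists (SigSub (mem_set ry.1)). Qed.

(** Confinement passes from the shard to its closure by density and continuity. *)
Lemma confined_restr S Delta gamma g r (y : type_shard r) :
  confined S Delta -> S r -> Delta gamma -> is_extension gamma g ->
  type_shard r (restr r g y).
Proof.
move=> cS Sr Dg gg; apply: (@closed_closure _ (shard r)) => U nU.
have [z [rz Uz]] := shard_dense _ _ _ (restr_continuous gg nU).
have [x xz rx] := shard_states _ _ rz.
exists (restr r g z); split => //; rewrite (restr_states _ _ _ _ _ gg xz).
by apply: subset_closure; apply: (cS gamma r Dg Sr (gamma x)); exists x.
Qed.

(** Condition (ii) for a single shard. *)
Definition obstructed Delta r := forall (P : predicates C) (a b : R)
    (gamma : nat -> states C -> states C),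
  a < b -> (forall n, Delta (gamma n)) ->
  exists E F : set nat, [/\ finite_set E, finite_set F, E `&` F = set0 &
    (set_val @^-1` shard r : set (states C)) `&`
    \bigcap_(n in E) ((coordinate P \o set_val \o gamma n) @^-1` `]-oo, a]) `&`
    \bigcap_(n in F) ((coordinate P \o set_val \o gamma n) @^-1` `[b, +oo[)
    = set0].

Lemma ext_restr_continuous Delta r
    (u : type_shard r -> {ptws predicates C -> R}) :
  ext_restr Delta r u -> continuous u.
Proof. by move=> [g [gamma _ gg] <-]; exact: restr_continuous gg. Qed.

Lemma coordinate_cvg (I : Type) (F : set_system I)
    (h : I -> {ptws predicates C -> R}) (y : {ptws predicates C -> R}) P :
  Filter F -> h @ F --> y -> h i P @[i --> F] --> y P.
Proof. by move=> FF /ptws_cvgP/(_ P). Qed.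

Lemma continuous_coordinate (T : topologicalType)
    (h : T -> {ptws predicates C -> R}) P :
  continuous h -> continuous (fun x => h x P).
Proof. by move=> ch x; apply: coordinate_cvg; exact: ch. Qed.

(** The obstruction concerns states only; applied at levels strictly inside [a] and [b], it passes
    to limit types, since a type following the pattern has nearby states that meet the inner
    levels. *)
Lemma obstructed_pattern Delta r (P : predicates C) (a b : R)
    (u : nat -> type_shard r -> {ptws predicates C -> R}) :
  obstructed Delta r -> a < b -> (forall n, ext_restr Delta r (u n)) ->
  exists k (e : nat -> bool), forall x, ~ forall i, (i < k)%N ->
    if e i then b <= u i x P else u i x P <= a.
Proof.
move=> obs ab uD; pose a' := (a + b) / 2; pose b' := (a' + b) / 2.
have aa' : a < a' by rewrite midf_lt.
have a'b : a' < b by rewrite midf_lt.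
have a'b' : a' < b' by rewrite midf_lt.
have b'b : b' < b by rewrite midf_lt.
have /choice[gamma gP] : forall n, exists gamma, Delta gamma /\
    exists2 g, is_extension gamma g & restr r g = u n.
  move=> n; have [g [gamma Dg gg] <-] := uD n.
  by exists gamma; split => //; exists g.
have [E [F [finE finF EF0 EF]]] := obs P a' b' gamma a'b' (fun n => (gP n).1).
have [k kEF] : exists k, forall n, (E `|` F) n -> (n < k)%N.
  have : finite_set (E `|` F) by rewrite finite_setU.
  move=> /finite_seqP[s ->]; exists (\max_(i <- s) i).+1 => n ns.
  by rewrite ltnS; exact: (@leq_bigmax_seq _ s xpredT id n).
(* Indices outside [E] and [F] are put on the low side; this only adds constraints. *)
exists k, (fun n => n \in F) => y yp.
have [z [rz zp]] : exists z : type_shard r, shard r (set_val z) /\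
    forall i : 'I_k, if val i \in F then b' < u i z P else u i z P < a'.
  pose near_u (i : 'I_k) :=
    [set z | if val i \in F then b' < u i z P else u i z P < a'].
  apply: (@shard_dense r y [set z | forall i, near_u i z]).
  apply: (@filter_forall _ _ near_u (nbhs y)) => i.
  have cu : u i z P @[z --> y] --> u i y P.
    exact: (coordinate_cvg _ _ _ _ _ _ (ext_restr_continuous _ _ _ (uD i) y)).
  have := yp i (ltn_ord i); rewrite /near_u/=; case: ifPn => _ h.
    by apply: (cvgr_gt _ cu); exact: lt_le_trans h.
  by apply: (cvgr_lt _ cu); exact: le_lt_trans aa'.
have [x xz rx] := shard_states _ _ rz.
have uE n : u n z P = set_val (gamma n x) P.
  by have [_ [g gg <-]] := gP n; rewrite (restr_states _ _ _ _ _ gg xz).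
suff : (set0 : set (states C)) x by [].
rewrite -EF; split; first split => //.
- move=> n En; have nk := kEF n (or_introl En).
  have := zp (Ordinal nk); rewrite /= uE in_itv/= /coordinate.
  case: ifPn => [/set_mem Fn|_ /ltW//].
  by suff : (set0 : set nat) n by []; rewrite -EF0.
- move=> n Fn; have nk := kEF n (or_intror Fn).
  have := zp (Ordinal nk); rewrite /= uE in_itv/= /coordinate andbT.
  by rewrite mem_set// => /ltW.
Qed.

(** A countable dense family [d] makes [f] a limit along an ultrafilter on [nat], from which a
    sequence is sampled. *)
Lemma closure_ext_restr_sequence Delta r
    (f : {ptws type_shard r -> {ptws predicates C -> R}}) :
  countable [set: predicates C] -> obstructed Delta r ->
  closure (ext_restr Delta r) f ->
  exists2 u : nat -> type_shard r -> {ptws predicates C -> R},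
    forall n, ext_restr Delta r (u n) & forall x, u n x @[n --> \oo] --> f x.
Proof.
move=> cC obs Df; have [iC iC_inj] := countable_index cC.
have [|d dD Dd] := ptws_separable iC iC_inj (type_shard r) (ext_restr Delta r) _
    (@ext_restr_continuous Delta r).
  by have [g [Dg _]] := Df setT filterT; exists g.
have df : closure (range d) f by apply: closed_closure; exact: closureS Df.
have [p [pU _ dpf]] := closure_image_ultra _ _ _ _ _ df.
have [x q|q a b m ab|g gf] := @ultra_limit_sequence R _ _ p d f cC pU.
- apply: (@coordinate_cvg _ p (fun n => d n x) (f x)).
  by move/ptws_cvgP : dpf; exact.
- exact: (obstructed_pattern _ _ _ _ _ (d \o m) obs ab (fun n => dD (m n))).
exists (d \o g) => [n|x]; first exact: dD.
by apply/ptws_cvgP => q; exact: gf.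
Qed.

Lemma sequence_baire1 S Delta r
    (u : nat -> type_shard r -> {ptws predicates C -> R}) f :
  confined S Delta -> S r -> (forall n, ext_restr Delta r (u n)) ->
  (forall x, u n x @[n --> \oo] --> f x) ->
  [set set_val \o g | g in baire1 (type_shard r) (type_shard r)] f.
Proof.
move=> cS Sr uD uf.
have uK n x : type_shard r (u n x).
  by have [g [gamma Dg gg] <-] := uD n; exact: confined_restr cS Sr Dg gg.
have fK x : type_shard r (f x).
  apply: closed_closure => U /uf[N _ /(_ N (leqnn N)) UN].
  by exists (u N x); split; [exact: uK | exact: UN].
exists (fun x => SigSub (mem_set (fK x))) => //.
exists (fun n x => SigSub (mem_set (uK n x))); split=> [n|x].
  apply: continuous_to_subtype; exact: (ext_restr_continuous _ _ _ (uD n)).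
by apply/subtype_cvgP; exact: uf.
Qed.

Lemma is_extension_seq Delta r (gamma : nat -> states C -> states C) :
  (forall gamma, Delta gamma -> extendable gamma) ->
  (forall n, Delta (gamma n)) ->
  exists g, forall n,
    is_extension (gamma n) (g n) /\ ext_restr Delta r (restr r (g n)).
Proof.
move=> extD Dg; have /choice[g gP] n : exists g, is_extension (gamma n) g.
  exact: extD.
by exists g => n; split => //; exists (g n) => //; exists (gamma n).
Qed.

Lemma baire1_obstructed S Delta r :
  confined S Delta -> S r -> (forall gamma, Delta gamma -> extendable gamma) ->
  closure (ext_restr Delta r) `<=`
    [set set_val \o g | g in baire1 (type_shard r) (type_shard r)] ->
  obstructed Delta r.
Proof.
move=> cS Sr extD clB P a b gamma ab Dgamma.
have [g gP] := is_extension_seq Delta r gamma extD Dgamma.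
have cK := type_shard_compact r.
(* Refining the filter of eventual properties lets the limit respect whatever holds for all large
   [n]. *)
have [p [pU oop]] := ultraFilterLemma eventually_filter.
have /choice[f fP] x : exists y : {ptws predicates C -> R},
    restr r (g n) x @[n --> p] --> y.
  have [|y _ yP] := @compact_ultra_cvg _ _ _ p (fun n => restr r (g n) x) cK pU.
    apply: filterS filterT => n _.
    exact: confined_restr cS Sr (Dgamma n) (gP n).1.
  by exists y.
pose v n x := restr r (g n) x P.
have vf x : v n x @[n --> p] --> f x P by exact: coordinate_cvg (fP x).
have [w [wK [cwK wKw]] wf] : exists2 w, baire1 (type_shard r) (type_shard r) w &
    set_val \o w = f.
  (* The family already contains these restrictions; writing it as a union reduces the claim to the
     closure of the sequence. *)
  apply: clB; have -> : ext_restr Delta r = ext_restr Delta r `|`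
      [set restr r (g n) | n in setT].
    by apply/seteqP; split=> [h|h [//|[n _ <-]]]; [left | case: (gP n)].
  rewrite closureU; right; apply: (@closure_image_cvg _ _ _ _ p) filterT _.
  by apply/ptws_cvgP.
have f_le x : p [set n | v n x <= a] -> f x P <= a.
  move=> pv; rewrite leNgt; apply/negP => /(cvgr_gt _ (vf x)) pv'.
  have [n [/= /le_lt_trans/[apply]]] := filter_ex (filterI pv pv').
  by rewrite ltxx.
have f_ge x : p [set n | b <= v n x] -> b <= f x P.
  move=> pv; rewrite leNgt; apply/negP => /(cvgr_lt _ (vf x)) pv'.
  have [n [/= /lt_le_trans/[apply]]] := filter_ex (filterI pv' pv).
  by rewrite ltxx.
have cu n : continuous (restr r (g n)).
  exact: restr_continuous (gP n).1.
have [k [e ke]] : exists k (e : nat -> bool), forall x, ~ forall i, (i < k)%N ->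
    if e i then b <= v i x else v i x <= a.
  (* If every pattern were realised, [v] would be independent and [f] could not be of the first
     Baire class. *)
  apply: contrapT => nke.
  apply: (@independent_not_baire1 R (type_shard r) v a b _ _ ab _
    (fun x => f x P) (fun n x => set_val (wK n x) P)).
  - exact: compact_subtype cK.
  - move=> n; exact: continuous_coordinate (cu n).
  - move=> k e; apply: contrapT => ne; apply: nke; exists k, e => x xe.
    by apply: ne; exists x.
  - move=> n; apply: (continuous_coordinate _ (set_val \o wK n)) => x.
    by apply: continuous_comp; [exact: cwK | exact: initial_continuous].
  - move=> x; rewrite -wf.
    apply: (coordinate_cvg _ _ (fun n => set_val (wK n x))).
    exact: cvg_set_val (wKw x).
  - by move=> x /oop; exact: f_le.
  - by move=> x /oop; exact: f_ge.
  (* The ultrafilter decides on which side of the gap the values lie. *)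
  - move=> x gx; have [/f_le|pN] := in_ultra_setVsetC [set n | v n x <= a] pU.
      by left.
    by right; apply: f_ge; apply: filterS pN => n /= vn; case: (gx n).
exists [set i | (i < k)%N && ~~ e i], [set i | (i < k)%N && e i]; split.
- by apply: sub_finite_set (finite_II k) => i /andP[].
- by apply: sub_finite_set (finite_II k) => i /andP[].
- by apply/seteqP; split => // i [/andP[_ /negP]] + /andP[].
apply/seteqP; split => // x [[rx xE] xF].
have Kx : type_shard r (set_val x) by exact: subset_closure.
apply: (ke (SigSub (mem_set Kx))) => i ik.
have vE : v i (SigSub (mem_set Kx)) = coordinate P (set_val (gamma i x)).
  by rewrite /v (restr_states _ _ _ x _ (gP i).1).
rewrite vE; case: ifPn => ei.
  by have := xF i; rewrite /= ik ei in_itv/= andbT; exact.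
by have := xE i; rewrite /= ik ei in_itv/=; exact.
Qed.

(** Along an ultrafilter on [Delta] tending to [f], confinement and compactness give limits of the
    extensions on each shard of [S]; uniqueness of limits gives agreement with [f]. *)
Lemma deep_extension S Delta (f : states C -> types C) :
  exhaustive S -> confined S Delta ->
  (forall gamma, Delta gamma -> extendable gamma) ->
  deep_computations Delta f ->
  exists f' : shard_types C -> shard_types C,
    (forall x, set_val (f' (subfun (states_sub_shard_types C) x)) =
               set_val (f x)) /\
    forall r, S r -> closure (ext_restr Delta r) (restr r f').
Proof.
move=> exhS cS extD deepf.
have [p [pU pD pf]] := closure_image_ultra _ _ _ _ _ deepf.
have /choice[ext extP] gamma :
    exists g, Delta gamma -> is_extension gamma g.
  have [/extD[g gg]|nD] := pselect (Delta gamma); first by exists g.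
  by exists id.
pose lim_at (x y : shard_types C) := set_val (ext gamma x) @[gamma --> p] -->
  (set_val y : {ptws predicates C -> R}).
(* Where no limit exists, which may happen outside the shards of [S], the arbitrary value [x] is
   taken. *)
have /choice[f' f'P] x : exists y, (exists y', lim_at x y') -> lim_at x y.
  have [[y xy]|nlim] := pselect (exists y, lim_at x y); first by exists y.
  by exists x.
have f'_lim r (z : type_shard r) : S r ->
    restr r (ext gamma) z @[gamma --> p] --> restr r f' z.
  move=> Sr; have [|y yK yP] := @compact_ultra_cvg _ _ (type_shard r) p
      (fun gamma => restr r (ext gamma) z) (type_shard_compact r) pU.
    apply: filterS pD => gamma Dg.
    exact: confined_restr cS Sr Dg (extP _ Dg).
  have := f'P (subfun (@type_shard_sub _ _ r) z); apply.
  by exists (subfun (@type_shard_sub _ _ r) (SigSub (mem_set yK))).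
exists f'; split=> [x|r Sr].
  (* Exhaustiveness places each state in a shard where the limit is known to exist. *)
  have [r Sr rx] : exists2 r, S r & shard r (set_val x).
    have : states C `<=` \bigcup_(r in S) shard r by rewrite -exhS.
    by move=> /(_ _ (set_valP x))[r Sr rx]; exists r.
  have zx := mem_set (subset_closure rx : type_shard r (set_val x)).
  have xf : set_val (gamma x) @[gamma --> p] --> set_val (f x).
    have /ptws_cvgP/(_ x) := pf.
    exact: cvg_set_val.
  have xf' : set_val (gamma x) @[gamma --> p] --> restr r f' (SigSub zx).
    apply: cvg_trans (f'_lim r (SigSub zx) Sr).
    apply: near_eq_cvg; apply: filterS pD => gamma Dg.
    by rewrite (restr_states _ _ _ x _ (extP _ Dg)).
  have hausP : hausdorff_space {ptws predicates C -> R}.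
    by apply: hausdorff_product => P; exact: Rhausdorff.
  rewrite (cvg_unique hausP xf xf') /restr.
  by congr (set_val (f' _)); exact/val_inj.
pose h gamma : {ptws type_shard r -> {ptws predicates C -> R}} :=
  restr r (ext gamma).
have : closure (h @` Delta) (restr r f').
  apply: (@closure_image_cvg _ _ _ _ p) pD _.
  by apply/ptws_cvgP => z; exact: f'_lim.
apply: closureS => _ [gamma Dg <-].
by exists (ext gamma) => //; exists gamma => //; exact: extP.
Qed.

End Shards.

(** * The equivalence and the extension of deep computations *)

Theorem theorem3p1 (R : realType) (C : ccs R)
    (extC : extendability_axiom C)
    (countC : countable [set: predicates C])
    (S : set (predicates C -> {posnum R})) (exhS : exhaustive S)
    (Delta : set (states C -> states C))
    (subDelta : Delta `<=` computations C)
    (confDelta : confined S Delta) :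
  let cond_i := forall r, S r ->
    closure (ext_restr Delta r) `<=`
      [set set_val \o g | g in baire1 (type_shard r) (type_shard r)] in
  let cond_ii := forall (P : predicates C) r (a b : R)
      (gamma : nat -> states C -> states C),
    S r -> a < b -> (forall n, Delta (gamma n)) ->
    exists E F : set nat, [/\ finite_set E, finite_set F, E `&` F = set0 &
      (set_val @^-1` shard r : set (states C)) `&`
      \bigcap_(n in E) ((coordinate P \o set_val \o gamma n) @^-1` `]-oo, a]) `&`
      \bigcap_(n in F) ((coordinate P \o set_val \o gamma n) @^-1` `[b, +oo[)
      = set0] in
  (cond_i <-> cond_ii) /\
  (cond_i -> forall f : states C -> types C, deep_computations Delta f ->
    exists f' : shard_types C -> shard_types C,
      [/\ forall x, set_val (f' (subfun (states_sub_shard_types C) x)) =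
                    set_val (f x),
          forall r, S r ->
            exists2 g, baire1 (type_shard r) (type_shard r) g &
              forall x, set_val (g x) = restr r f' x
        & forall r, S r ->
            exists2 u : nat -> type_shard r -> {ptws predicates C -> R},
              forall n, ext_restr Delta r (u n) &
              forall x, u n x @[n --> \oo] --> restr r f' x]).
Proof.
move=> cond_i cond_ii.
have extD gamma : Delta gamma -> extendable gamma by move=> /subDelta/extC.
have iP : cond_i -> forall r, S r -> obstructed Delta r.
  by move=> Hi r Sr; apply: (baire1_obstructed S) => //; exact: Hi.
have iiP : cond_ii -> forall r, S r -> obstructed Delta r.
  by move=> Hii r Sr P a b gamma; exact: Hii.
split; first split.
- by move=> /iP obs P r a b gamma Sr; exact: obs.
- move=> /iiP obs r Sr f.
  move=> /(closure_ext_restr_sequence _ _ _ countC (obs r Sr))[u uD uf].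
  exact: sequence_baire1 confDelta Sr uD uf.
move=> Hi f /(deep_extension S _ _ exhS confDelta extD)[f' [f'E f'D]].
exists f'; split => // r Sr.
  by have [g Bg gE] := Hi r Sr _ (f'D r Sr); exists g => // x; rewrite -gE.
exact: closure_ext_restr_sequence countC (iP Hi r Sr) (f'D r Sr).
Qed.
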